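(* Let $T$ be a tree with at least $3$ vertices, and fix integers $d\ge 2$ and $\ell\ge 0$. Then $\mathbf{G}_T$ determines $L_{d,\ell}(T)$: if $T'$ is another tree with at least $3$ vertices and $\mathbf{G}_T=\mathbf{G}_{T'}$, then $L_{d,\ell}(T)=L_{d,\ell}(T')$.
   Context: All graphs are finite and simple. For a tree $T$ and $A\subseteq V(T)$, $e(A)$ is the number of edges of $T$ with both endpoints in $A$ and $d(A)$ the number with exactly one endpoint in $A$; $\mathbf{G}_T(x,y,z)=\sum_{A\subseteq V(T)} x^{|A|}y^{d(A)}z^{e(A)}$. For $v\in V(T)$, $\ell(v)$ is the number of leaves of $T$ adjacent to $v$, and $L_{d,\ell}(T)$ is the number of vertices $v$ with $\deg(v)=d$ and $\ell(v)=\ell$. *)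

(* Defs.v *)
From HB Require Import structures.
From mathcomp Require Import all_boot all_order all_algebra.
From mathcomp Require Import mpoly.

Set Implicit Arguments.
Unset Strict Implicit.
Unset Printing Implicit Defensive.

Import GRing.Theory.
Local Open Scope ring_scope.

Record sgraph := SGraph {
  vertex :> finType;
  adj : rel vertex;
  adj_sym : ssrbool.symmetric adj;
  adj_irr : irreflexive adj
}.

Section SimpleGraph.
Variable G : sgraph.
Implicit Types (v : G) (A : {set G}).

Definition edges : {set {set G}} :=
  [set E : {set G} | [exists x : G, exists y : G, adj x y && (E == [set x; y])]].

Definition neighbours v : {set G} := [set u : G | adj v u].

Definition deg v : nat := #|neighbours v|.

Definition leaf v : bool := deg v == 1%N.

Definition connected_graph : Prop :=
  (0 < #|G|)%N /\ forall x y : G, connect (@adj G) x y.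

(* A cycle has at least three vertices: the closed walk [:: x; y] along a
   single edge satisfies ucycle but is not a cycle of a simple graph. *)
Definition acyclic : Prop :=
  forall c : seq G, (3 <= size c)%N -> ~ ucycle (@adj G) c.

Definition is_tree : Prop := connected_graph /\ acyclic.

Definition inner_edges A : nat := #|[set E in edges | E \subset A]|.

Definition boundary_edges A : nat := #|[set E in edges | #|E :&: A| == 1%N]|.

(* 'X_0, 'X_1 and 'X_2 are the variables x, y and z. *)
Definition gen_degree_poly : {mpoly int[3]} :=
  \sum_(A : {set G})
    'X_(inord 0) ^+ #|A| * 'X_(inord 1) ^+ boundary_edges A
      * 'X_(inord 2) ^+ inner_edges A.

Definition num_leaf_neighbours v : nat := #|[set u in neighbours v | leaf u]|.

Definition num_deg_leaf (d l : nat) : nat :=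
  #|[set v : G | (deg v == d) && (num_leaf_neighbours v == l)]|.

End SimpleGraph.

(* Main.v *)
Require Import Defs.
From HB Require Import structures.
From mathcomp Require Import all_boot all_order all_algebra.
From mathcomp Require Import mpoly.
From mathcomp Require Import ring zify.

(* By the handshake identity d(A) + 2 e(A) = sum_{v in A} deg v, the polynomial G_T
   determines F_T(X) = sum_A (X - 1)^|A| y^(sum_{v in A} (deg v - 1)) t^e(A) with
   t = 1 + (1 - w) X.  Since no two leaves are adjacent, the sum over the leaves in A
   factors over leaves: a leaf contributes X if its neighbour is outside A and
   X (w + (1 - w) X) if it is inside.  Hence F_T = X^L Q_T, with L the number of
   leaves, and Q_T(0) is a sum over sets B of non-leaves in which t = 1, so it is the
   product over non-leaves v of 1 - y^(deg v - 1) w^l(v).  It is nonzero, hence F_T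
   determines it.  With w = y^N and N large, the exponents of a product of factors
   1 - y^e, e > 0, are determined up to order, and each of them encodes a pair
   (deg v, l(v)). *)

Set Implicit Arguments.
Unset Strict Implicit.
Unset Printing Implicit Defensive.

Import GRing.Theory Num.Theory.
Local Open Scope ring_scope.

(** * Counting edges inside a vertex set *)

Section EdgeCounts.
Variable G : sgraph.
Implicit Types (u v : G) (A B C : {set G}).

Lemma mem_edges2 u v : ([set u; v] \in edges G) = adj u v.
Proof.
rewrite inE; apply/existsP/idP => [[a /existsP[b /andP[ab /eqP E]]]|uv]; last first.
  by exists u; apply/existsP; exists v; rewrite uv eqxx.
have ne_ab : a != b by apply: contraTneq ab => ->; rewrite adj_irr.
have : (a \in [set u; v]) && (b \in [set u; v]) by rewrite E !inE !eqxx orbT.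
rewrite !inE => /andP[/orP[]/eqP Ea /orP[]/eqP Eb]; subst a b => //.
- by rewrite eqxx in ne_ab.
- by rewrite adj_sym.
- by rewrite eqxx in ne_ab.
Qed.

Lemma edge_through u (E : {set G}) :
  E \in edges G -> u \in E -> exists2 v, adj u v & E = [set u; v].
Proof.
rewrite inE => /existsP[a /existsP[b /andP[ab /eqP->]]].
rewrite !inE => /orP[]/eqP->; first by exists b.
by exists a; [rewrite adj_sym | rewrite setUC].
Qed.

Lemma card_edge (E : {set G}) : E \in edges G -> #|E| = 2.
Proof.
rewrite inE => /existsP[a /existsP[b /andP[ab /eqP->]]].
by rewrite cards2; case: eqP ab => // ->; rewrite adj_irr.
Qed.

Lemma neighbours_edge_inj u : {in neighbours u &, injective (fun v => [set u; v])}.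
Proof.
move=> v w; rewrite !inE => uv uw E.
have : v \in [set u; w] by rewrite -E !inE eqxx orbT.
by rewrite !inE => /orP[]/eqP // vu; rewrite vu adj_irr in uv.
Qed.

Lemma card_incident v : #|[set E in edges G | v \in E]| = deg v.
Proof.
rewrite /deg -(card_in_imset (@neighbours_edge_inj v)); apply: eq_card => E.
apply/idP/imsetP => [|[u]]; rewrite inE.
  by case/andP=> /edge_through h /h[u vu ->]; exists u; rewrite ?inE.
by rewrite inE => vu ->; rewrite mem_edges2 vu !inE eqxx.
Qed.

(** Double counting of pairs of a vertex in [A] and an edge through it: an edge [E] is counted
    [#|E :&: A|] times, which is 2 for inner edges, 1 for boundary edges and 0 otherwise. *)
Lemma handshake A : (boundary_edges A + 2 * inner_edges A = \sum_(v in A) deg v)%N.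
Proof.
under [RHS]eq_bigr do rewrite -card_incident -sum1_card.
rewrite (exchange_big_dep (mem (edges G))) /=; last first.
  by move=> v E _; rewrite inE => /andP[].
rewrite /boundary_edges /inner_edges -!sum1dep_card !big_mkcondr /=.
rewrite big_distrr -big_split /=; apply: eq_bigr => E Eedge.
under eq_bigl do rewrite inE Eedge /=.
rewrite sum1dep_card.
have -> : [set x in A | x \in E] = E :&: A by apply/setP=> x; rewrite !inE andbC.
have := subset_leq_card (subsetIl E A); rewrite (card_edge Eedge).
have -> : (E \subset A) = (#|E :&: A| == 2).
  by rewrite -(card_edge Eedge) (sameP setIidPl eqP) eqEcard subsetIl /= eqn_leq
    (subset_leq_card (subsetIl E A)).
by case: #|_| => [|[|[]]].
Qed.

Lemma inner_edges_setU1 u A :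
  u \notin A -> inner_edges (u |: A) = (inner_edges A + #|neighbours u :&: A|)%N.
Proof.
move=> uA; set I := [set E in edges G | E \subset A].
have inj : {in neighbours u :&: A &, injective (fun v => [set u; v])}.
  by move=> v w /setIP[uv _] /setIP[uw _]; apply: neighbours_edge_inj.
rewrite -(card_in_imset inj) /inner_edges -/I.
set J := imset _ _.
have dIJ : [disjoint I & J].
  rewrite disjoint_sym; apply/pred0P => E /=; apply/andP => -[/imsetP[v _ ->]].
  rewrite inE => /andP[_ /subsetP/(_ u)].
  by rewrite !inE eqxx => /(_ isT); rewrite (negbTE uA).
rewrite -(eqTleqif (leq_card_setU I J) dIJ); apply: eq_card => E.
apply/idP/idP; last first.
  rewrite in_setU => /orP[|/imsetP[v]].
    by rewrite !inE => /andP[-> /subset_trans]; apply; apply: subsetU1.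
  rewrite !inE => /andP[uv vA] ->; have := mem_edges2 u v; rewrite inE uv => -> /=.
  by rewrite subUset !sub1set !inE eqxx vA orbT.
rewrite inE => /andP[Ee EA]; rewrite in_setU.
have [uE|uE] := boolP (u \in E).
  have [v uv Euv] := edge_through Ee uE.
  apply/orP; right; apply/imsetP; exists v => //; rewrite !inE uv.
  have /(subsetP EA) : v \in E by rewrite Euv !inE eqxx orbT.
  by rewrite !inE => /orP[/eqP vu|//]; rewrite vu adj_irr in uv.
rewrite inE Ee /=; apply/orP; left; apply/subsetP => v vE.
have := subsetP EA v vE; rewrite !inE => /orP[/eqP vu|//].
by rewrite -vu vE in uE.
Qed.

Hypothesis leaf_leaf : forall u v, leaf u -> leaf v -> ~~ adj u v.

(** Leaves of [C] are added to [B] one at a time. As no two leaves are adjacent, each brings only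
    its edges into [B]. *)
Lemma inner_edges_leaves B C :
    {in B, forall v, ~~ leaf v} -> {in C, forall u, leaf u} ->
  inner_edges (B :|: C) = (inner_edges B + \sum_(u in C) #|neighbours u :&: B|)%N.
Proof.
move=> Bn; have [n] := ubnP #|C|; elim: n C => // n IH C leC Cl.
have [->|[u uC]] := set_0Vmem C; first by rewrite setU0 big_set0 addn0.
have uB : u \notin B by apply: contraTN (Cl u uC) => /Bn.
rewrite (big_setD1 u) //= -{1}(setD1K uC) setUCA inner_edges_setU1; last first.
  by rewrite !inE (negbTE uB) eqxx.
rewrite IH; first last.
- by move=> v; rewrite !inE => /andP[_ /Cl].
- by rewrite [#|C|](cardsD1 u) uC in leC.
rewrite -addnA; congr addn; rewrite addnC; congr addn.
apply: eq_card => v; rewrite !inE; case: (boolP (adj u v)) => //= uv.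
case: (boolP (v \in C)) => [vC|_]; last by rewrite andbF orbF.
by have := leaf_leaf (Cl u uC) (Cl v vC); rewrite uv.
Qed.

End EdgeCounts.

(** * Summing out the leaves *)

Section LeafSum.
Variable R : comNzRingType.

Lemma sum_subset_prod (I : finType) (D : {set I}) (r : I -> R) :
  \sum_(C : {set I} | C \subset D) \prod_(i in C) r i = \prod_(i in D) (1 + r i).
Proof.
rewrite [RHS]big_mkcond /=.
under [RHS]eq_bigr => i _.
  (* The value 0 outside [D] kills the sets not contained in [D] once the product is expanded. *)
  rewrite (_ : (if _ then _ else _) = (if i \in D then r i else 0) + 1); last first.
    by case: ifP => _; rewrite ?add0r // addrC.
  over.
rewrite bigA_distr /= [RHS](bigID (fun C : {set I} => C \subset D)) /=.
rewrite [X in _ + X]big1 ?addr0 => [|C /subsetPn[i iC iD]]; last first.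
  by rewrite (bigD1 i) //= iC (negbTE iD) mul0r.
apply: eq_big => [C|C CD]; first by rewrite ?inE.
rewrite [LHS]big_mkcond /=; apply: eq_bigr => i _.
by case: ifP => // /(subsetP CD)->.
Qed.

Variable G : sgraph.
Hypothesis leaf_leaf : forall u v : G, leaf u -> leaf v -> ~~ adj u v.

Definition leaves : {set G} := [set u | leaf u].

(** Each [A] splits uniquely as [B :|: C] with [C] its leaves. For fixed [B], the weight is
    multiplicative over [C], so the sum over [C] becomes a product over all leaves. *)
Lemma sum_over_leaves (a t : R) (f : G -> R) :
    (forall u, leaf u -> f u = a) ->
  \sum_(A : {set G}) t ^+ inner_edges A * \prod_(v in A) f v =
  \sum_(B : {set G} | B \subset ~: leaves)
    (t ^+ inner_edges B * \prod_(v in B) f v)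
      * \prod_(u in leaves) (1 + a * t ^+ #|neighbours u :&: B|).
Proof.
move=> fa.
rewrite (partition_big (fun A => A :\: leaves) (fun B => B \subset ~: leaves)) /=;
  last by move=> A _; rewrite setDE subsetIr.
apply: eq_bigr => B BnL.
rewrite (reindex_onto (fun C => B :|: C) (fun A => A :&: leaves)) /=; last first.
  by move=> A /eqP<-; rewrite setUC setID.
have dBL : B :&: leaves = set0.
  by apply/eqP; rewrite setI_eq0 disjoints_subset.
have Bn : {in B, forall v, ~~ leaf v}.
  by move=> v /(subsetP BnL); rewrite !inE.
rewrite -sum_subset_prod mulr_sumr; apply: eq_big => [C|C].
  rewrite setIUl dBL set0U (sameP setIidPl eqP) setDUl.
  have -> : B :\: leaves = B by apply/setDidPl; rewrite disjoints_subset.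
  case: (boolP (C :&: leaves == C)) => [/eqP/setIidPl|]; last by rewrite andbF.
  by rewrite -setD_eq0 => /eqP->; rewrite setU0 eqxx.
rewrite setIUl dBL set0U => /andP[_ /eqP/setIidPl CL].
have Cl : {in C, forall u, leaf u} by move=> u /(subsetP CL); rewrite inE.
rewrite inner_edges_leaves // exprD big_split /= prodrXr.
rewrite [\prod_(v in B :|: C) _](eq_bigl (mem [predU B & C])) => [|v]; last by rewrite /= !inE.
rewrite bigU /=; last first.
  by rewrite disjoint_sym; apply: disjointWl CL _; rewrite -setI_eq0 setIC dBL.
rewrite [\prod_(i in C) f i](eq_bigr (fun=> a)); last by move=> u /Cl/fa.
by rewrite -!mulrA; congr (_ * _); rewrite mulrCA; congr (_ * _); rewrite mulrC.
Qed.

End LeafSum.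

(** * Factorisation for connected graphs on at least three vertices *)

Section Connected.
Variable G : sgraph.
Hypotheses (conn : connected_graph G) (cG : (3 <= #|G|)%N).

Lemma connected_deg_gt0 (v : G) : (0 < deg v)%N.
Proof.
rewrite lt0n cards_eq0; apply/eqP => N0.
have cl : closed (@adj G) [set v].
  apply: intro_closed => [|x y]; first exact/sym_connect_sym/adj_sym.
  by rewrite !inE => xy /eqP Ex; have := in_set0 y; rewrite -N0 inE -Ex xy.
suff : (#|G| <= #|[set v]|)%N by rewrite cards1 => /(leq_trans cG).
rewrite -cardsT; apply/subset_leq_card/subsetP => x _.
by rewrite -(closed_connect cl (conn.2 v x)) inE.
Qed.

(** Two adjacent leaves would form a whole connected component, of only two vertices. *)
Lemma connected_leaf_leaf (u v : G) : leaf u -> leaf v -> ~~ adj u v.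
Proof.
move=> lu lv; apply/negP => uv.
have only (a b : G) : leaf a -> adj a b -> forall c, adj a c -> c = b.
  move=> /cards1P[x Nx] ab c ac.
  have : (b \in [set x]) && (c \in [set x]) by rewrite -Nx !inE ab ac.
  by rewrite !inE => /andP[/eqP-> /eqP->].
have cl : closed (@adj G) [set u; v].
  apply: intro_closed => [|x y]; first exact/sym_connect_sym/adj_sym.
  rewrite !inE => xy /orP[]/eqP Ex; rewrite Ex in xy.
    by rewrite (only _ _ lu uv _ xy) eqxx orbT.
  by rewrite (only v u lv _ _ xy) ?eqxx // adj_sym.
suff : (#|G| <= #|[set u; v]|)%N.
  by rewrite cards2 => /(leq_trans cG); case: (u != v).
rewrite -cardsT; apply/subset_leq_card/subsetP => x _.
by rewrite -(closed_connect cl (conn.2 u x)) !inE eqxx.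
Qed.

Lemma sum_leaf_neighbours (B : {set G}) :
  (\sum_(u in leaves G) #|neighbours u :&: B| =
   \sum_(v in B) num_leaf_neighbours v)%N.
Proof.
under eq_bigr do rewrite -sum1_card.
under [RHS]eq_bigr do rewrite /num_leaf_neighbours -sum1_card.
rewrite (exchange_big_dep (mem B)) /=; last by move=> u v _; rewrite inE => /andP[].
apply: eq_bigr => v vB; apply: eq_bigl => u.
by rewrite !inE vB andbT andbC adj_sym.
Qed.

Lemma card_leaf_neighbours (u : G) (B : {set G}) :
  leaf u -> (#|neighbours u :&: B| <= 1)%N.
Proof. by move=> /eqP<-; apply/subset_leq_card/subsetIl. Qed.

(* The value x = (X - 1) / y makes a leaf whose neighbour lies outside A contribute
   1 + x y = X, and z = y^2 t is chosen so that a leaf whose neighbour lies in A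
   also contributes a multiple of X.  By the handshake identity the weight of A is
   then (X - 1)^|A| y^(sum of (deg v - 1)) t^e(A), so no inverse of y is needed. *)
Lemma leaf_factorisation (K : comNzRingType) (y w : K) :
  let t : {poly K} := 1 + (1 - w)%:P * 'X in
  exists2 Q : {poly K},
    \sum_(A : {set G}) ('X - 1) ^+ #|A|
        * y%:P ^+ (boundary_edges A + 2 * inner_edges A - #|A|)
        * t ^+ inner_edges A = 'X ^+ #|leaves G| * Q
    & Q.[0] = \prod_(v in ~: leaves G)
                (1 - y ^+ (deg v).-1 * w ^+ num_leaf_neighbours v).
Proof.
move=> t; pose f (v : G) : {poly K} := ('X - 1) * y%:P ^+ (deg v).-1.
(* Chosen so that [1 + ('X - 1) * t = 'X * s], the factor of a leaf whose neighbour lies in [B]. *)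
pose s : {poly K} := w%:P + (1 - w)%:P * 'X.
exists (\sum_(B : {set G} | B \subset ~: leaves G)
   (t ^+ inner_edges B * \prod_(v in B) f v)
     * s ^+ (\sum_(v in B) num_leaf_neighbours v)).
  transitivity (\sum_(A : {set G}) t ^+ inner_edges A * \prod_(v in A) f v).
    apply: eq_bigr => A _; rewrite mulrC big_split /= prodr_const prodrXr handshake.
    (* Degrees are positive, so the truncated subtraction distributes over the sum. *)
    congr (_ * (_ * _ ^+ _)); rewrite -sum1_card -sumnB => [|v _].
      by apply: eq_bigr => v _; rewrite subn1.
    exact: connected_deg_gt0.
  rewrite (sum_over_leaves connected_leaf_leaf (a := 'X - 1)); last first.
    by move=> u /eqP du; rewrite /f du expr0 mulr1.
  rewrite mulr_sumr; apply: eq_bigr => B _.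
  rewrite mulrCA; congr (_ * _); rewrite -sum_leaf_neighbours -prodrXr -prodr_const.
  rewrite -big_split /=; apply: eq_bigr => u; rewrite inE => lu.
  case: #|_| (card_leaf_neighbours B lu) => [|[|//]] _.
    by rewrite !expr0 !mulr1 addrC subrK.
  rewrite /t /s !expr1 polyCB; ring.
(* At 0 one has [t = 1], [s = w] and [f v = - y ^+ (deg v).-1], which leaves an expanded product
   over the non-leaves. *)
rewrite -sum_subset_prod horner_sum; apply: eq_bigr => B _.
rewrite !hornerM !horner_exp horner_prod -prodrXr /t /s.
rewrite !hornerE /= ?mulr0 ?addr0 expr1n mul1r -big_split /=.
apply: eq_bigr => v _; rewrite /f !hornerE /= ?horner_exp ?hornerE; ring.
Qed.

End Connected.

(** * Recovering exponents from a product of factors [1 - 'X^e] *)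

(** After cancelling the smaller power of ['X], any power left over would make one of the values at
    0 vanish. *)
Lemma eval0_of_eq_mulXn (K : idomainType) (a b : nat) (P Q : {poly K}) :
    'X^a * P = 'X^b * Q -> P.[0] != 0 -> Q.[0] != 0 -> P.[0] = Q.[0].
Proof.
wlog le_ab : a b P Q / (a <= b)%N => [IH|].
  have [le_ab|/ltnW le_ba E P0 Q0] := leqP a b; first exact: IH.
  by rewrite (IH _ _ _ _ le_ba (esym E)).
rewrite -(subnKC le_ab) exprD -mulrA => /(mulfI _) -> //; last first.
  by rewrite expf_neq0 // polyX_eq0.
case: (b - a)%N => [|c]; first by rewrite expr0 mul1r.
by rewrite hornerM hornerXn expr0n mul0r eqxx.
Qed.

(** Modulo ['X^(k.+1)], factors with exponent above [k] are 1, and since [k > 0] products of two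
    terms ['X^k] vanish. *)
Lemma prod_1subXn_truncation (K : comNzRingType) (k : nat) (s : seq nat) :
    (0 < k)%N -> all (leq k) s ->
  exists q : {poly K}, \prod_(e <- s) (1 - 'X^e) =
    1 - 'X^k *+ count_mem k s + 'X^(k.+1) * q.
Proof.
case: k => // k _; elim: s => [|e s IH] /=.
  by exists 0; rewrite big_nil mulr0n subr0 mulr0 addr0.
move=> /andP[ke /IH[q E]]; rewrite big_cons E; case: eqVneq => [->|ne].
  exists (q + 'X^k *+ count_mem k.+1 s - 'X^(k.+1) * q).
  rewrite add1n mulrS !exprS; move: (count_mem _ _) => c; ring.
have {}ke : (k.+2 <= e)%N by rewrite ltn_neqAle eq_sym ne.
rewrite -(subnKC ke) exprD.
exists (q - 'X^(e - k.+2) * (1 - 'X^(k.+1) *+ count_mem k.+1 s + 'X^(k.+2) * q)).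
rewrite add0n; move: (count_mem _ _) => c; ring.
Qed.

Lemma prod_1subXn_neq0 (P : pred nat) (s : seq nat) :
  all (leq 1) s -> \prod_(e <- s | P e) (1 - 'X^e) != 0 :> {poly int}.
Proof.
move=> s_gt0; rewrite prodf_seq_neq0; apply/allP => e /(allP s_gt0) e_gt0.
by apply/implyP => _; rewrite -size_poly_eq0 -opprB size_polyN size_XnsubC.
Qed.

(** Strong induction on the exponent [k]: factors with smaller exponents agree and cancel, and then
    the coefficient of ['X^k] gives the multiplicity of [k]. *)
Lemma prod_1subXn_inj (s s' : seq nat) :
    all (leq 1) s -> all (leq 1) s' ->
    \prod_(e <- s) (1 - 'X^e) = \prod_(e <- s') (1 - 'X^e) :> {poly int} ->
  perm_eq s s'.
Proof.
move=> s_gt0 s'_gt0 E; apply/allP => k _ /=; apply/eqP.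
elim/ltn_ind: k => k IH.
have [->|k_gt0] := posnP k.
  have c0 r : all (leq 1) r -> count_mem 0%N r = 0%N.
    by move=> r_gt0; apply/count_memPn; apply/negP => /(allP r_gt0).
  by rewrite !c0.
have low : perm_eq [seq e <- s | e < k]%N [seq e <- s' | e < k]%N.
  apply/allP => j _ /=; rewrite !count_filter; apply/eqP.
  have [jk|jk] := ltnP j k.
    rewrite -[LHS]/(count _ _) (eq_count (a2 := pred1 j)) => [|e] /=.
      rewrite IH //; apply: eq_count => e /=.
      by case: eqP => // ->; rewrite jk.
    by case: eqP => // ->; rewrite jk.
  rewrite !(eq_count (a2 := pred0)) ?count_pred0 // => e /=;
  by case: eqP => // ->; rewrite ltnNge jk.
move: E; rewrite (bigID (fun e => e < k)%N) [RHS](bigID (fun e => e < k)%N) /=.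
rewrite -[X in _ = X * _]big_filter -(perm_big _ low) big_filter.
move/(mulfI (prod_1subXn_neq0 _ s_gt0)).
under eq_bigl do rewrite -leqNgt.
under [RHS]eq_bigl do rewrite -leqNgt.
rewrite -big_filter -[RHS]big_filter.
have ge_k r : all (leq k) [seq e <- r | k <= e]%N by apply: filter_all.
have [q ->] := prod_1subXn_truncation int k_gt0 (ge_k s).
have [q' ->] := prod_1subXn_truncation int k_gt0 (ge_k s').
have cnt r : count_mem k [seq e <- r | k <= e]%N = count_mem k r.
  by rewrite count_filter; apply: eq_count => e /=; case: eqP => // ->; rewrite leqnn.
move/(congr1 (fun p : {poly int} => p`_k)).
rewrite !cnt !coefD !coefN !coefXnM ltnSn !coefMn !coefXn eqxx !addr0.
by move/addrI/oppr_inj/eqP; rewrite /= eqr_nat => /eqP.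
Qed.

(** * From the polynomial to the leaf statistics *)

(** Distinct triples give distinct monomials, so each coefficient counts the sets with a given
    triple. Hence any sum over [A] of a function of its triple is determined, without substituting
    values for the variables. *)
Lemma gen_degree_poly_perm (G H : sgraph) :
    gen_degree_poly G = gen_degree_poly H ->
  perm_eq [seq (#|A|, boundary_edges A, inner_edges A)
             | A : {set G} <- enum {: {set G}}]
          [seq (#|A|, boundary_edges A, inner_edges A)
             | A : {set H} <- enum {: {set H}}].
Proof.
pose mon (c : nat * nat * nat) : 'X_{1..3} :=
  (U_(inord 0) *+ c.1.1 + U_(inord 1) *+ c.1.2 + U_(inord 2) *+ c.2)%MM.
have monI : injective mon.
  move=> [[a b] c] [[a' b'] c'] E.
  have ev (i : 'I_3) := congr1 (fun m : 'X_{1..3} => m i) E.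
  have := (ev (inord 0), ev (inord 1), ev (inord 2)).
  rewrite /mon !mnmDE !mulmnE !mnm1E -!val_eqE /= !inordK //=.
  by rewrite !mul1n !mul0n !addn0 !add0n => -[[-> ->] ->].
have coefE (F : sgraph) (c : nat * nat * nat) :
    (gen_degree_poly F)@_(mon c) =
    (count_mem c [seq (#|A|, boundary_edges A, inner_edges A)
                 | A : {set F} <- enum {: {set F}}])%:R.
  rewrite raddf_sum /= count_map -sum1_count natr_sum big_enum_cond.
  rewrite big_mkcond [RHS]big_mkcond /=.
  apply: eq_bigr => A _; rewrite !mpolyXn -!mpolyXD mcoeffX.
  rewrite -[X in X == mon c]/(mon (#|A|, boundary_edges A, inner_edges A)).
  rewrite (inj_eq monI).
  by case: eqP.
move=> E; apply/allP => c _ /=.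
by have := coefE G c; rewrite E coefE => /eqP; rewrite eqr_nat eq_sym.
Qed.

Theorem theorem4p9 (d l : nat) (hd : (2 <= d)%N) (T T' : sgraph)
    (hT : is_tree T) (hT' : is_tree T')
    (cT : (3 <= #|T|)%N) (cT' : (3 <= #|T'|)%N)
    (hG : gen_degree_poly T = gen_degree_poly T') :
  num_deg_leaf T d l = num_deg_leaf T' d l.
Proof.
(* Base-N digits: the code of v determines the pair (deg v, l(v)). *)
pose N := (#|T| + #|T'| + d)%N.
pose code (G : sgraph) (v : G) := ((deg v).-1 + N * num_leaf_neighbours v)%N.
pose codes (G : sgraph) := [seq code G v | v <- enum (~: leaves G)].
have codes_gt0 (G : sgraph) : is_tree G -> (3 <= #|G|)%N -> all (leq 1) (codes G).
  move=> [cG _] c3; apply/allP => _ /mapP[v vL ->].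
  move: vL; rewrite mem_enum !inE => nl.
  have := connected_deg_gt0 cG c3 v; move: nl; rewrite /leaf /code; lia.
have codes_num (G : sgraph) : is_tree G -> (3 <= #|G|)%N -> (#|G| <= N)%N ->
    num_deg_leaf G d l = count_mem (d.-1 + N * l)%N (codes G).
  move=> [cG _] c3 leN; rewrite count_map -sum1_count big_enum_cond sum1dep_card /=.
  apply: eq_card => v; rewrite !inE /leaf /code.
  have := connected_deg_gt0 cG c3 v; have : (deg v <= #|G|)%N := max_card _.
  move: (deg v) (num_leaf_neighbours v) => m k mG m_gt0.
  (* Both low digits are below [N], so the remainder and the quotient modulo [N] recover the
     pair. *)
  have mN : (m.-1 < N)%N by lia.
  have dN : (d.-1 < N)%N by rewrite /N; lia.
  (* Since [d >= 2], a vertex of degree [d] is never a leaf, so restricting [codes] to non-leaves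
     loses nothing. *)
  apply/andP/andP => [[/eqP-> /eqP->]|[_ /eqP E]]; first by split; lia.
  rewrite ![(_.-1 + _)%N]addnC ![(N * _)%N]mulnC in E.
  have := congr1 (modn^~ N) E; rewrite /= !modnMDl !modn_small // => Em.
  have := congr1 (divn^~ N) E; rewrite /= !divnMDl ?divn_small //; lia.
have prodE (G : sgraph) :
    \prod_(v in ~: leaves G)
      (1 - 'X ^+ (deg v).-1 * ('X^N) ^+ num_leaf_neighbours v) =
    \prod_(e <- codes G) (1 - 'X^e) :> {poly int}.
  rewrite big_map big_enum /=; apply: eq_bigr => v _.
  by rewrite -exprM -exprD.
rewrite !codes_num //; [|by rewrite /N; lia..].
apply/permP; apply: prod_1subXn_inj; [exact: codes_gt0..|].
have [Q EQ Q0] := leaf_factorisation hT.1 cT 'X ('X^N : {poly int}).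
have [Q' EQ' Q'0] := leaf_factorisation hT'.1 cT' 'X ('X^N : {poly int}).
rewrite prodE in Q0; rewrite prodE in Q'0.
rewrite -Q0 -Q'0; apply: (@eval0_of_eq_mulXn _ #|leaves T| #|leaves T'|).
- rewrite -EQ -EQ'.
  (* The summand of [leaf_factorisation] depends on [A] only through its triple. *)
  pose F (c : nat * nat * nat) : {poly {poly int}} :=
    ('X - 1) ^+ c.1.1 * 'X%:P ^+ (c.1.2 + 2 * c.2 - c.1.1)
      * (1 + (1 - 'X^N)%:P * 'X) ^+ c.2.
  have := perm_big _ (gen_degree_poly_perm hG) (op := +%R) (x := 0)
    (P := xpredT) (F := F).
  by rewrite !big_map -!enumT !big_enum.
- by rewrite Q0 prod_1subXn_neq0 ?codes_gt0.
- by rewrite Q'0 prod_1subXn_neq0 ?codes_gt0.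
Qed.
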